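(* Let $X$ be a (nondegenerate) conic in the real projective plane $\mathbb{RP}^2$, and let $a,b,c,d,e,f$ be six points of $X$, not necessarily distinct. Put $$A_1=\overline{ab},\quad A_2=\overline{de},\quad B_1=\overline{bc},\quad B_2=\overline{ef},\quad C_1=\overline{cd},\quad C_2=\overline{fa},$$ and assume $A_1\neq A_2$, $B_1\neq B_2$ and $C_1\neq C_2$. Then the three intersection points $A_1\cap A_2$, $B_1\cap B_2$, $C_1\cap C_2$ are collinear, i.e. there is a line of $\mathbb{RP}^2$ containing all three.
   Context: For points $x,y$ on a conic $X$, $\overline{xy}$ denotes the line through $x$ and $y$ if $x\neq y$, and the tangent line to $X$ at $x$ if $x=y$. *)

(* Defs.v *)
From HB Require Import structures.
From mathcomp Require Import all_boot all_order all_algebra.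
From mathcomp Require Import reals.

Set Implicit Arguments.
Unset Strict Implicit.
Unset Printing Implicit Defensive.

Import GRing.Theory.
Local Open Scope ring_scope.

(* The projective plane over R: points and lines are the linear subspaces of  *)
(* R^3 of dimension 1 and 2, and incidence is inclusion of subspaces.         *)
Record rp2_point (R : realType) := RP2Point {
  point_space :> {vspace 'rV[R]_3};
  point_dim : \dim point_space == 1%N }.

HB.instance Definition _ (R : realType) := [isSub for @point_space R].
HB.instance Definition _ (R : realType) := [Choice of rp2_point R by <:].

Record rp2_line (R : realType) := RP2Line {
  line_space :> {vspace 'rV[R]_3};
  line_dim : \dim line_space == 2%N }.

HB.instance Definition _ (R : realType) := [isSub for @line_space R].
HB.instance Definition _ (R : realType) := [Choice of rp2_line R by <:].

Lemma dim_meet (R : realType) (L M : rp2_line R) :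
  L != M -> \dim (L :&: M)%VS == 1%N.
Proof.
move=> neLM; have dL := eqP (line_dim L); have dM := eqP (line_dim M).
have dLM : \dim (L + M)%VS = 3%N.
  apply/eqP; rewrite eqn_leq; apply/andP; split.
    by rewrite (leq_trans (dimvS (subvf _))) // dimvf.
  rewrite ltnNge; apply/negP => le2; move/negP: neLM; apply.
  have eL : (L == L + M :> {vspace _})%VS.
    by rewrite eqEdim addvSl dL.
  have eM : (M == L + M :> {vspace _})%VS.
    by rewrite eqEdim addvSr dM.
  by apply/eqP/val_inj; rewrite /= (eqP eL) -(eqP eM).
by have := dimv_sum_cap L M; rewrite dLM dL dM => /(@addnI 3 _ 1) ->.
Qed.

Definition meet (R : realType) (L M : rp2_line R) (neLM : L != M) :
  rp2_point R := RP2Point (dim_meet neLM).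

Definition collinear (R : realType) (x y z : rp2_point R) : Prop :=
  exists L : rp2_line R, [/\ (x <= L)%VS, (y <= L)%VS & (z <= L)%VS].

(* A nondegenerate conic is given by a nondegenerate quadratic form           *)
(* q(v) = v M v^T, with M the symmetric Gram matrix. Its real locus is not    *)
(* required to be nonempty.                                                   *)
Record conic (R : realType) := Conic {
  conic_mx : 'M[R]_3;
  conic_sym : conic_mx^T = conic_mx;
  conic_nondeg : conic_mx \in unitmx }.

Definition on_conic (R : realType) (X : conic R) (x : rp2_point R) : Prop :=
  forall v, v \in (x : {vspace _}) -> v *m conic_mx X *m v^T = 0.

(* The differential of q at v is w |-> 2 (w M v^T), so the tangent line at    *)
(* [v] is the kernel of w |-> w M v^T. Here v = vpick x is a nonzero vector   *)
(* of x; another representative gives the same kernel.                        *)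
Definition tangent_space (R : realType) (X : conic R) (x : rp2_point R) :
    {vspace 'rV[R]_3} :=
  lker (linfun (mulmxr (conic_mx X *m (vpick x)^T) : 'rV[R]_3 -> 'rV[R]_1)).

Lemma dim_tangent (R : realType) (X : conic R) (x : rp2_point R) :
  \dim (tangent_space X x) = 2%N.
Proof.
rewrite /tangent_space; set f := linfun _.
have nzv : vpick x != 0 by rewrite vpick0 -dimv_eq0 (eqP (point_dim x)).
have nzu : conic_mx X *m (vpick x)^T != 0.
  apply: contraNneq nzv => /(congr1 (mulmx (invmx (conic_mx X)))).
  rewrite mulKmx ?conic_nondeg // mulmx0 => /(congr1 trmx).
  by rewrite trmxK trmx0 => ->.
have := limg_ker_dim f fullv; rewrite capfv dimvf.
suff -> : \dim (f @: fullv)%VS = 1%N by rewrite addn1 => -[].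
apply/eqP; rewrite eqn_leq; apply/andP; split.
  by rewrite (leq_trans (dimvS (subvf _))) // dimvf.
rewrite lt0n dimv_eq0; apply: contraNneq nzu => f0.
apply/eqP/row_matrixP => i; rewrite row0 rowE.
have : f (delta_mx 0 i) \in (f @: fullv)%VS by rewrite memv_img ?memvf.
by rewrite f0 memv0 lfunE => /eqP.
Qed.

Definition chord_space (R : realType) (X : conic R) (x y : rp2_point R) :
    {vspace 'rV[R]_3} :=
  if x == y then tangent_space X x else (x + y)%VS.

Lemma dim_chord (R : realType) (X : conic R) (x y : rp2_point R) :
  \dim (chord_space X x y) == 2%N.
Proof.
rewrite /chord_space; case: ifPn => [_|nexy]; first by rewrite dim_tangent.
have dx := eqP (point_dim x); have dy := eqP (point_dim y).
rewrite dimv_disjoint_sum ?dx ?dy //; apply/eqP; rewrite -dimv_eq0.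
apply: contraNT nexy; rewrite -lt0n => cap_gt0.
have ex : (x :&: y == x :> {vspace _})%VS by rewrite eqEdim capvSl dx.
have ey : (x :&: y == y :> {vspace _})%VS by rewrite eqEdim capvSr dy.
by apply/eqP/val_inj; rewrite /= -(eqP ex) {1}(eqP ey).
Qed.

(* The line through x and y, which is the tangent to X at x when x = y.       *)
Definition chord (R : realType) (X : conic R) (x y : rp2_point R) :
  rp2_line R := RP2Line (dim_chord X x y).

(* Main.v *)
Require Import Defs.
From mathcomp Require Import all_boot all_order all_algebra.
From mathcomp Require Import reals ring.

Set Implicit Arguments.
Unset Strict Implicit.
Unset Printing Implicit Defensive.

Import GRing.Theory Num.Theory.
Local Open Scope ring_scope.

(** A conic with a real point is, in suitable coordinates, a multiple of
[x z - y^2], so its points are the values [(s^2, s t, t^2)] of the Veronese map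
on the projective line ([conic_normal_form], [veronese_parameter]). In these
coordinates the line through the points with parameters [(s, t)] and [(s', t')]
has the equation [t t' x - (s t' + t s') y + s s' z = 0]. It is the tangent
when the two parameters agree, and its coefficients never all vanish: one
bilinear formula covers chords and tangents alike ([chordE]), so that no case
of coinciding points needs separate treatment.

Two distinct lines meet in the cross product of their coefficient vectors
([meet_sub_hyperplane]). Pascal's theorem thus becomes the vanishing of the
determinant of three cross products, a polynomial identity in the twelve
parameters of the six points ([pascal_det]). A nonzero vector orthogonal to the
three cross products gives the line sought; it exists even when some of the
three intersection points coincide. *)

(** * Vectors and covectors in dimension three *)

Section Triples.
Variable F : fieldType.
Implicit Types u v w : 'rV[F]_3.

Definition vec3 (x y z : F) : 'rV[F]_3 := \row_i [:: x; y; z]`_i.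

Definition rows3 u v w : 'M[F]_3 := \matrix_i [:: u; v; w]`_i.

Lemma vec3_eta v : exists x y z, v = vec3 x y z.
Proof.
exists (v 0 0), (v 0 1), (v 0 2%:R); apply/rowP => i; rewrite mxE.
by case: i => [[|[|[|//]]] hi] /=; congr (v _ _); apply: val_inj.
Qed.

Lemma vec3_inj x y z x' y' z' :
  vec3 x y z = vec3 x' y' z' -> [/\ x = x', y = y' & z = z'].
Proof. by move=> /rowP E; move: (E 0) (E 1) (E 2%:R); rewrite !mxE. Qed.

Lemma vec3_0 : vec3 0 0 0 = 0.
Proof. by apply/rowP => -[[|[|[|//]]] hi]; rewrite !mxE. Qed.

Lemma vec3Z k x y z : k *: vec3 x y z = vec3 (k * x) (k * y) (k * z).
Proof. by apply/rowP => -[[|[|[|//]]] hi]; rewrite !mxE. Qed.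

Lemma vec3D x y z x' y' z' :
  vec3 x y z + vec3 x' y' z' = vec3 (x + x') (y + y') (z + z').
Proof. by apply/rowP => -[[|[|[|//]]] hi]; rewrite !mxE. Qed.

Lemma vec3_dot x y z x' y' z' :
  vec3 x y z *m (vec3 x' y' z')^T = (x * x' + y * y' + z * z')%:M.
Proof.
rewrite [LHS]mx11_scalar !mxE; congr _%:M.
by rewrite !big_ord_recl big_ord0 !mxE /= addr0 addrA.
Qed.

Lemma vec3_rows3 x y z u v w :
  vec3 x y z *m rows3 u v w = x *: u + y *: v + z *: w.
Proof.
by rewrite mulmx_sum_row !big_ord_recl big_ord0 !rowK !mxE /= addr0 addrA.
Qed.

Lemma mul_rows3 (n : nat) u v w (A : 'M[F]_(3, n)) i :
  row i (rows3 u v w *m A) = [:: u *m A; v *m A; w *m A]`_i.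
Proof. by rewrite row_mul rowK; case: i => [[|[|[|//]]] hi]. Qed.

Lemma rows3_eq (A : 'M[F]_3) u v w :
  row 0 A = u -> row 1 A = v -> row 2%:R A = w -> A = rows3 u v w.
Proof.
move=> <- <- <-; apply/row_matrixP => i; rewrite rowK.
by case: i => [[|[|[|//]]] hi] /=; congr (row _ A); apply: val_inj.
Qed.

Lemma scalar_mx11_eq0 (x : F) : (x%:M == 0 :> 'M_1) = (x == 0).
Proof.
by apply/eqP/eqP => [/matrixP/(_ 0 0)|->]; rewrite ?mxE // raddf0.
Qed.

Lemma det3 (A : 'M[F]_3) : \det A =
  A 0 0 * (A 1 1 * A 2%:R 2%:R - A 1 2%:R * A 2%:R 1)
  - A 0 1 * (A 1 0 * A 2%:R 2%:R - A 1 2%:R * A 2%:R 0)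
  + A 0 2%:R * (A 1 0 * A 2%:R 1 - A 1 1 * A 2%:R 0).
Proof.
pose B (i j : nat) := A (inord i) (inord j).
have E : forall i j : 'I_3, A i j = B i j by move=> i j; rewrite /B !inord_val.
rewrite (expand_det_row _ 0) !big_ord_recl big_ord0 /cofactor.
rewrite !(expand_det_row _ 0) !big_ord_recl !big_ord0 /cofactor !det_mx11 !mxE.
by rewrite !E /= /bump /=; ring.
Qed.

Definition cross u v : 'rV[F]_3 :=
  vec3 (u 0 1 * v 0 2%:R - u 0 2%:R * v 0 1)
       (u 0 2%:R * v 0 0 - u 0 0 * v 0 2%:R)
       (u 0 0 * v 0 1 - u 0 1 * v 0 0).

Lemma cross_vec3 x y z x' y' z' : cross (vec3 x y z) (vec3 x' y' z') =
  vec3 (y * z' - z * y') (z * x' - x * z') (x * y' - y * x').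
Proof. by rewrite /cross !mxE. Qed.

Lemma cross_eq0_parallel u v :
  u != 0 -> cross u v = 0 -> exists l, v = l *: u.
Proof.
case: (vec3_eta u) => [x [y [z ->]]]; case: (vec3_eta v) => [x' [y' [z' ->]]].
rewrite cross_vec3 -vec3_0 => nz /vec3_inj[/eqP + /eqP + /eqP].
rewrite !subr_eq0 => /eqP yz /eqP zx /eqP xy.
have [x0|x0] := eqVneq x 0; last first.
  exists (x' / x); rewrite vec3Z; congr vec3; apply: (mulfI x0).
  - by field.
  - by rewrite xy; field.
  - by rewrite -zx; field.
have [y0|y0] := eqVneq y 0; last first.
  exists (y' / y); rewrite vec3Z; congr vec3; apply: (mulfI y0).
  - by rewrite -xy; field.
  - by field.
  - by rewrite yz; field.
have [z0|z0] := eqVneq z 0; first by rewrite x0 y0 z0 vec3_0 eqxx in nz.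
exists (z' / z); rewrite vec3Z; congr vec3; apply: (mulfI z0).
- by rewrite zx; field.
- by rewrite -yz; field.
- by field.
Qed.

(** By the triple product expansion, [cross (cross m n) w] is the combination of
[m] and [n] with coefficients the products of [w] with [n] and [m], hence zero:
the intersection of two distinct planes is spanned by their cross product. *)
Lemma orthogonal_cross m n w :
  w *m m^T = 0 -> w *m n^T = 0 -> cross m n != 0 ->
  exists l, w = l *: cross m n.
Proof.
move=> wm wn /cross_eq0_parallel; apply; move: wm wn.
case: (vec3_eta m) => [m0 [m1 [m2 ->]]]; case: (vec3_eta n) => [n0 [n1 [n2 ->]]].
case: (vec3_eta w) => [w0 [w1 [w2 ->]]].
rewrite !vec3_dot !cross_vec3 => /eqP + /eqP.
rewrite !scalar_mx11_eq0 => /eqP wm /eqP wn.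
pose p := w0 * m0 + w1 * m1 + w2 * m2; pose q := w0 * n0 + w1 * n1 + w2 * n2.
transitivity (p *: vec3 n0 n1 n2 + (- q) *: vec3 m0 m1 m2).
  by rewrite !vec3Z vec3D /p /q; congr vec3; ring.
by rewrite /p /q wm wn oppr0 !scale0r addr0.
Qed.

Lemma orthogonal_to_three u v w :
  \det (rows3 u v w) = 0 ->
  exists2 n : 'cV[F]_3, n != 0 & [/\ u *m n = 0, v *m n = 0 & w *m n = 0].
Proof.
rewrite -det_tr => /eqP/det0P[n n0 /(congr1 trmx)].
rewrite trmx_mul trmxK trmx0 => E; exists n^T.
  by apply: contraNneq n0 => /(congr1 trmx); rewrite trmxK trmx0 => ->.
split.
- by move/(congr1 (row 0)): E; rewrite mul_rows3 row0.
- by move/(congr1 (row 1)): E; rewrite mul_rows3 row0.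
- by move/(congr1 (row 2%:R)): E; rewrite mul_rows3 row0.
Qed.

Lemma exists_orthogonal (u v : 'cV[F]_3) :
  exists2 e : 'rV[F]_3, e != 0 & e *m u = 0 /\ e *m v = 0.
Proof.
have : \rank (kermx (row_mx u v)) != 0%N.
  by rewrite mxrank_ker -lt0n subn_gt0; exact: leq_ltn_trans (rank_leq_col _) _.
rewrite mxrank_eq0 => /rowV0Pn[e /sub_kermxP + e0]; rewrite mul_mx_row => E.
by exists e => //; move: E; rewrite -row_mx0 => /eq_row_mx.
Qed.

End Triples.

(** * The standard conic and its chords *)

(** The Gram matrix of [2 (x z - y^2)]. *)
Definition std_conic {F : fieldType} : 'M[F]_3 :=
  rows3 (vec3 0 0 1) (vec3 0 (- 2%:R) 0) (vec3 1 0 0).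

Definition veronese {F : fieldType} (p : F * F) :=
  vec3 (p.1 ^+ 2) (p.1 * p.2) (p.2 ^+ 2).

(** The coefficients of the line through [veronese p] and [veronese q]: on the
Veronese curve the linear form restricts to the product of the two binary
linear forms that vanish at [p] and at [q]. *)
Definition vchord {F : fieldType} (p q : F * F) :=
  vec3 (p.2 * q.2) (- (p.1 * q.2 + p.2 * q.1)) (p.1 * q.1).

(** Pascal's theorem for the standard conic. The products of linear forms
[ab * cd * ef] and [bc * de * fa] restrict on the Veronese curve to the same
binary sextic, the product of the six forms that vanish at [a], ..., [f]. Their
difference is therefore a multiple of [x z - y^2], and for six points in general
position the linear cofactor is nonzero and vanishes at the three intersection
points, which lie off the conic. The determinant is a polynomial in the
coordinates of the parameters, so it vanishes identically. *)
Lemma pascal_det (F : fieldType) (a b c d e f : F * F) :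
  \det (rows3 (cross (vchord a b) (vchord d e))
              (cross (vchord b c) (vchord e f))
              (cross (vchord c d) (vchord f a))) = 0.
Proof.
move: a b c d e f => [a0 a1] [b0 b1] [c0 c1] [d0 d1] [e0 e1] [f0 f1].
rewrite det3 /vchord !cross_vec3 !mxE /=; ring.
Qed.

(** * Reduction of a conic with a point to the standard conic *)

Section NormalForm.
Variables (F : fieldType) (M : 'M[F]_3).
Hypothesis two_neq0 : 2%:R != 0 :> F.
Hypotheses (Msym : M^T = M) (Munit : M \in unitmx).

Definition pairing (u v : 'rV[F]_3) : F := (u *m M *m v^T) 0 0.

Lemma pairing_sym u v : pairing u v = pairing v u.
Proof.
rewrite /pairing; set s := u *m M *m v^T.
have -> : s = s^T by rewrite [s]mx11_scalar tr_scalar_mx.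
by rewrite !trmx_mul trmxK Msym mulmxA.
Qed.

Lemma pairingDl u u' v : pairing (u + u') v = pairing u v + pairing u' v.
Proof. by rewrite /pairing !mulmxDl mxE. Qed.

Lemma pairingZl k u v : pairing (k *: u) v = k * pairing u v.
Proof. by rewrite /pairing -!scalemxAl mxE. Qed.

Lemma pairingDr u v v' : pairing u (v + v') = pairing u v + pairing u v'.
Proof. by rewrite ![pairing u _]pairing_sym pairingDl. Qed.

Lemma pairingZr k u v : pairing u (k *: v) = k * pairing u v.
Proof. by rewrite ![pairing u _]pairing_sym pairingZl. Qed.

Lemma pairing_nondeg u : u != 0 -> exists v, pairing u v = 1.
Proof.
move=> u0; have : u *m M != 0.
  apply: contraNneq u0 => /(congr1 (mulmx^~ (invmx M))).
  by rewrite mulmxK // mul0mx => ->.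
case/rV0Pn => i ui; exists (((u *m M) 0 i)^-1 *: delta_mx 0 i).
by rewrite pairingZr /pairing trmx_delta -colE [col _ _ _ _]mxE mulVf.
Qed.

(** A line through the isotropic point [a] that is not tangent meets the conic
again: [c] is the second intersection, found by moving along [a]. *)
Lemma exists_isotropic a : a != 0 -> pairing a a = 0 ->
  exists2 c, pairing a c = 1 & pairing c c = 0.
Proof.
move=> /pairing_nondeg[w aw] aa; exists (w + (- (pairing w w / 2%:R)) *: a).
  by rewrite pairingDr pairingZr aa aw mulr0 addr0.
rewrite !(pairingDr, pairingDl, pairingZr, pairingZl) aa (pairing_sym w a) aw.
by field.
Qed.

Lemma pairing_rows3 x u v w : x *m M *m (rows3 u v w)^T =
  vec3 (pairing x u) (pairing x v) (pairing x w).
Proof.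
apply/rowP => i; rewrite !mxE; case: i => [[|[|[|//]]] hi] /=;
by rewrite /pairing mxE; apply: eq_bigr => j _; rewrite !mxE.
Qed.

Lemma gramE u v w : rows3 u v w *m M *m (rows3 u v w)^T =
  rows3 (vec3 (pairing u u) (pairing u v) (pairing u w))
        (vec3 (pairing v u) (pairing v v) (pairing v w))
        (vec3 (pairing w u) (pairing w v) (pairing w w)).
Proof.
by apply: rows3_eq; rewrite -mulmxA mul_rows3 /= mulmxA pairing_rows3.
Qed.

(** The vectors [a], [e], [c] form a basis; if [e] were isotropic, it would be
orthogonal to all of them, against nondegeneracy. *)
Lemma hyperbolic_complement_anisotropic a c e : e != 0 ->
  pairing a a = 0 -> pairing c c = 0 -> pairing a c = 1 ->
  pairing e a = 0 -> pairing e c = 0 -> pairing e e != 0.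
Proof.
move=> e0 aa cc ac ea ec; apply: contraTneq Munit => ee.
have Tunit : rows3 a e c \in unitmx.
  rewrite unitmxE unitfE; apply/det0P => -[v v0 vT].
  case: (vec3_eta v) v0 vT => x [y [z ->]] v0 vT.
  have pair_vT w : x * pairing a w + y * pairing e w + z * pairing c w = 0.
    rewrite -!pairingZl -!pairingDl -vec3_rows3 vT.
    by rewrite /pairing !mul0mx mxE.
  move: (pair_vT a) (pair_vT c); rewrite aa ea ac ec cc (pairing_sym c a) ac.
  rewrite !mulr0 !mulr1 !addr0 !add0r => z0 x0.
  move: vT; rewrite vec3_rows3 x0 z0 !scale0r addr0 add0r => /eqP.
  rewrite scaler_eq0 (negPf e0) orbF => /eqP y0.
  by move: v0; rewrite x0 y0 z0 vec3_0 eqxx.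
apply: contra e0 => Mu.
have : e *m (M *m (rows3 a e c)^T) = 0.
  by rewrite mulmxA pairing_rows3 ea ee ec vec3_0.
move/(congr1 (mulmx^~ (invmx (M *m (rows3 a e c)^T)))).
by rewrite mulmxK ?mul0mx => [->|]; rewrite ?unitmx_mul ?unitmx_tr ?Mu.
Qed.

(** In a basis [a], [e], [c] with [a], [c] isotropic and [e] orthogonal to both,
the quadratic form is [2 (a, c) x z + (e, e) y^2]. Rescaling [c] alone makes it
proportional to [x z - y^2], so no square root of [(e, e)] is taken. *)
Lemma conic_normal_form a : a != 0 -> pairing a a = 0 ->
  exists2 U : 'M_3, U \in unitmx &
    exists2 k, k != 0 & M = k *: (U *m std_conic *m U^T).
Proof.
move=> a0 aa; have [c ac cc] := exists_isotropic a0 aa.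
have [e e0 [ea ec]] := exists_orthogonal (M *m a^T) (M *m c^T).
have {}ea : pairing e a = 0 by rewrite /pairing -mulmxA ea mxE.
have {}ec : pairing e c = 0 by rewrite /pairing -mulmxA ec mxE.
have ee := hyperbolic_complement_anisotropic e0 aa cc ac ea ec.
(* For k = (a, k c), proportionality to the standard form means (e, e) = - 2 k. *)
pose k := - (pairing e e / 2%:R).
have k0 : k != 0 by rewrite oppr_eq0 mulf_neq0 ?invr_neq0.
pose T := rows3 a e (k *: c).
have gram : T *m M *m T^T = k *: std_conic.
  rewrite gramE !(pairingZl, pairingZr) aa cc ac ec ea.
  rewrite (pairing_sym a e) ea (pairing_sym c e) ec (pairing_sym c a) ac.
  apply/matrixP => i j; rewrite !mxE.
  case: i => [[|[|[|//]]] hi] /=; rewrite !mxE;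
  by case: j => [[|[|[|//]]] hj] /=; rewrite /k; field.
have stdunit : (std_conic : 'M[F]_3) \in unitmx.
  rewrite unitmxE unitfE; suff -> : \det std_conic = 2%:R :> F by [].
  by rewrite det3 !mxE /=; ring.
have Tunit : T \in unitmx.
  have : T *m M *m T^T \in unitmx by rewrite gram unitmxZ ?unitfE.
  by rewrite !unitmx_mul => /andP[/andP[]].
(* The rows of T are the new basis vectors, so T^-1 gives the coordinates. *)
exists (invmx T); first by rewrite unitmx_inv.
exists k => //; rewrite scalemxAl scalemxAr -gram trmx_inv !mulmxA.
by rewrite mulVmx // mul1mx mulmxK // unitmx_tr.
Qed.
End NormalForm.

(** * Points and lines as subspaces *)

Section Hyperplane.
Variable R : realType.

Definition hyperplane (n : 'cV[R]_3) : {vspace 'rV[R]_3} :=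
  lker (linfun (mulmxr n : 'rV[R]_3 -> 'rV[R]_1)).

Lemma mem_hyperplane n v : (v \in hyperplane n) = (v *m n == 0).
Proof. by rewrite memv_ker lfunE. Qed.

Lemma dim_hyperplane n : n != 0 -> \dim (hyperplane n) = 2%N.
Proof.
move=> n0; have := limg_ker_dim (linfun (mulmxr n : 'rV[R]_3 -> 'rV[R]_1)) fullv.
rewrite capfv dimvf; set f := linfun _.
suff -> : \dim (f @: fullv)%VS = 1%N by rewrite addn1 => -[].
apply/eqP; rewrite eqn_leq; apply/andP; split.
  by rewrite (leq_trans (dimvS (subvf _))) // dimvf.
rewrite lt0n dimv_eq0; apply: contraNneq n0 => f0.
apply/eqP/row_matrixP => i; rewrite row0 rowE.
have : f (delta_mx 0 i) \in (f @: fullv)%VS by rewrite memv_img ?memvf.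
by rewrite f0 memv0 lfunE => /eqP.
Qed.

Lemma line_eq_hyperplane (L : rp2_line R) n :
  n != 0 -> (L <= hyperplane n)%VS -> L = hyperplane n :> {vspace _}.
Proof.
by move=> n0 sub; apply/eqP; rewrite eqEdim sub dim_hyperplane ?(eqP (line_dim L)).
Qed.

Lemma vpick_neq0 (x : rp2_point R) : vpick x != 0.
Proof. by rewrite vpick0 -dimv_eq0 (eqP (point_dim x)). Qed.

Lemma point_subv (x : rp2_point R) (V : {vspace 'rV[R]_3}) :
  vpick x \in V -> (x <= V)%VS.
Proof.
rewrite memvE; apply: subv_trans.
suff /eqP-> : (<[vpick x]> == x :> {vspace _})%VS by [].
by rewrite eqEdim -memvE memv_pick dim_vline vpick_neq0 (eqP (point_dim x)).
Qed.

End Hyperplane.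

(** * Chords in the parametrization *)

Section Chords.
Variables (R : realType) (X : conic R) (U : 'M[R]_3) (k : R).
Hypotheses (Uunit : U \in unitmx) (k0 : k != 0).
Hypothesis XE : conic_mx X = k *: (U *m std_conic *m U^T).

Definition coordinates (x : rp2_point R) : 'rV[R]_3 := vpick x *m U.

Lemma coordinates_neq0 x : coordinates x != 0.
Proof.
apply: contraNneq (vpick_neq0 x) => /(congr1 (mulmx^~ (invmx U))).
by rewrite mulmxK // mul0mx => ->.
Qed.

(** On the conic [x z = y^2], the vector [(x, y, z)] is proportional to the values
of [veronese] at [(x, y)] and at [(y, z)], and one of these pairs is nonzero.
Using a function of the point, rather than some parameter of it, ensures that
equal points get equal parameters in [chordE]. *)
Definition parameter (x : rp2_point R) : R * R :=
  let w := coordinates x in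
  if w 0 0 != 0 then (w 0 0, w 0 1) else (w 0 1, w 0 2%:R).

Lemma veronese_parameter x : on_conic X x ->
  exists2 l, l != 0 & veronese (parameter x) = l *: coordinates x.
Proof.
move=> /(_ _ (memv_pick _)); rewrite XE.
rewrite -!scalemxAr -scalemxAl !mulmxA -(mulmxA _ U^T) -trmx_mul.
rewrite -/(coordinates x); move/eqP; rewrite scalemx_eq0 (negPf k0) /=.
rewrite /parameter; have := coordinates_neq0 x.
case: (vec3_eta (coordinates x)) => [x0 [x1 [x2 ->]]] nz.
rewrite vec3_rows3 !vec3Z !vec3D vec3_dot scalar_mx11_eq0 !mxE /=.
move=> /eqP E; have {}E : x1 ^+ 2 = x0 * x2.
  apply: (mulfI (_ : 2%:R != 0)); first by rewrite pnatr_eq0.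
  by apply/esym/eqP; rewrite -subr_eq0 -E; apply/eqP; ring.
case: eqP => [x00|/eqP x00] /=; rewrite /veronese /=.
  have x10 : x1 = 0 by apply/eqP; rewrite -sqrf_eq0 E x00 mul0r.
  exists x2; last by rewrite vec3Z x00 x10; congr vec3; ring.
  by apply: contraNneq nz => ->; rewrite x00 x10 vec3_0.
by exists x0; rewrite // vec3Z E; congr vec3; ring.
Qed.

(** The coefficients are, up to sign, those of the product of two nonzero binary
linear forms. *)
Lemma vchord_neq0 x y : on_conic X x -> on_conic X y ->
  vchord (parameter x) (parameter y) != 0.
Proof.
have param0 z : on_conic X z -> parameter z != (0, 0).
  move=> /veronese_parameter[l l0]; apply: contra_eqN => /eqP ->.
  rewrite /veronese /= !(mulr0, expr0n) vec3_0 eq_sym scaler_eq0.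
  by rewrite negb_or l0 coordinates_neq0.
move=> /param0 + /param0; case: (parameter x) (parameter y) => [s t] [s' t'].
move=> p0 q0; apply/eqP; rewrite -vec3_0 /vchord /=.
case/vec3_inj => /eqP tt /eqP + /eqP ss; rewrite oppr_eq0.
move: tt ss; rewrite !mulf_eq0.
case/orP => /eqP t0 /orP[]/eqP s0; move: p0 q0; rewrite t0 s0 ?eqxx //;
  rewrite !xpair_eqE ?eqxx ?andbT ?andTb ?(mul0r, mulr0, addr0, add0r);
  by rewrite mulf_eq0 => /negPf-> /negPf->.
Qed.

(** Dimensions being equal, an inclusion is enough. For [x != y] the two points
satisfy the equation. For [x = y] the tangent is the polar line of the point,
and the polar of [(s^2, s t, t^2)] is [(t^2, - 2 s t, s^2)], which is [vchord]
at two equal parameters. *)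
Lemma chordE x y : on_conic X x -> on_conic X y ->
  chord X x y =
    hyperplane (U *m (vchord (parameter x) (parameter y))^T) :> {vspace _}.
Proof.
move=> Xx Xy; apply: line_eq_hyperplane.
  apply: contraNneq (vchord_neq0 Xx Xy) => /(congr1 (mulmx (invmx U))).
  by rewrite mulKmx // mulmx0 => /(congr1 trmx); rewrite trmxK trmx0 => ->.
rewrite /chord /= /chord_space; case: eqP => [<-{y Xy}|_].
  apply/subvP => v; rewrite mem_hyperplane.
  rewrite memv_ker lfunE /= XE.
  have [l l0 ver] := veronese_parameter Xx.
  rewrite -!scalemxAl -!scalemxAr -!mulmxA -trmx_mul -/(coordinates x).
  rewrite scalemx_eq0 (negPf k0) /=.
  have -> : vchord (parameter x) (parameter x) =
      l *: (coordinates x *m std_conic).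
    rewrite scalemxAl -ver vec3_rows3 !vec3Z !vec3D /vchord.
    by congr vec3; ring.
  have stdT : std_conic^T = std_conic :> 'M[R]_3.
    apply/matrixP => i j; rewrite !mxE.
    by case: i => [[|[|[|//]]] hi]; case: j => [[|[|[|//]]] hj]; rewrite !mxE.
  rewrite linearZ /= (trmx_mul (coordinates x)) stdT -!scalemxAr => /eqP ->.
  by rewrite scaler0.
have on_chord z : on_conic X z ->
    veronese (parameter z) *m (vchord (parameter x) (parameter y))^T = 0 ->
    (z <= hyperplane (U *m (vchord (parameter x) (parameter y))^T))%VS.
  move=> /veronese_parameter[l l0 ->] /eqP.
  rewrite -scalemxAl scalemx_eq0 (negPf l0) => zc.
  by apply: point_subv; rewrite mem_hyperplane mulmxA.
rewrite subv_add !on_chord //; rewrite /veronese /vchord vec3_dot;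
  by apply/eqP; rewrite scalar_mx11_eq0; apply/eqP; ring.
Qed.

End Chords.

(** * Pascal's theorem *)

(** If the cross product [cross m n] were zero, [m] and [n] would be proportional
and the two lines equal; so it spans their intersection. *)
Lemma meet_sub_hyperplane (R : realType) (U : 'M[R]_3) (L L' : rp2_line R)
    (neLL' : L != L') (m n : 'rV[R]_3) (u : 'cV[R]_3) :
  m != 0 -> n != 0 ->
  L = hyperplane (U *m m^T) :> {vspace _} ->
  L' = hyperplane (U *m n^T) :> {vspace _} ->
  cross m n *m u = 0 -> (meet neLL' <= hyperplane (U *m u))%VS.
Proof.
move=> m0 n0 LE L'E mnu; apply/subvP => v /=; rewrite LE L'E memv_cap.
rewrite !mem_hyperplane !mulmxA => /andP[/eqP vm /eqP vn].
have mn0 : cross m n != 0.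
  apply: contraNneq neLL' => /(cross_eq0_parallel m0)[l nE].
  have l0 : l != 0 by apply: contraNneq n0 => l0; rewrite nE l0 scale0r.
  apply/eqP/val_inj; rewrite /= LE L'E; apply/vspaceP => w.
  by rewrite !mem_hyperplane nE linearZ /= -!scalemxAr scalemx_eq0 (negPf l0).
by have [l ->] := orthogonal_cross vm vn mn0; rewrite -scalemxAl mnu scaler0.
Qed.

Theorem mainTheorem1 (R : realType) (X : conic R) (a b c d e f : rp2_point R)
  (ha : on_conic X a) (hb : on_conic X b) (hc : on_conic X c)
  (hd : on_conic X d) (he : on_conic X e) (hf : on_conic X f)
  (hA : chord X a b != chord X d e)
  (hB : chord X b c != chord X e f)
  (hC : chord X c d != chord X f a) :
  collinear (meet hA) (meet hB) (meet hC).
Proof.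
have two0 : 2%:R != 0 :> R by rewrite pnatr_eq0.
have qa : pairing (conic_mx X) (vpick a) (vpick a) = 0.
  by rewrite /pairing (ha _ (memv_pick _)) mxE.
have [U Uunit [k k0 XE]] :=
  conic_normal_form two0 (conic_sym X) (conic_nondeg X) (vpick_neq0 a) qa.
pose p := parameter U.
have [u u0 [uA uB uC]] :=
  orthogonal_to_three (pascal_det (p a) (p b) (p c) (p d) (p e) (p f)).
have dimL : \dim (hyperplane (U *m u)) == 2%N.
  rewrite dim_hyperplane //; apply: contraNneq u0.
  by move/(congr1 (mulmx (invmx U))); rewrite mulKmx // mulmx0 => ->.
have chord_p := chordE Uunit k0 XE; have p0 := vchord_neq0 Uunit k0 XE.
exists (RP2Line dimL).
by split; (apply: meet_sub_hyperplane;
  [apply: p0 | apply: p0 | apply: chord_p | apply: chord_p |]).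
Qed.
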